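(* Consider a tiling of a closed oriented surface by quadrilateral tiles. Assume that the vertices of the tiling are colored black and white so that every edge connects vertices of different color. Associate to each black vertex a point, and to each white vertex a line, in the real (resp. complex) projective plane, so that all these points and lines are distinct and no point lies on any of the lines associated with adjacent vertices. For each tile, with vertices labeled in cyclic order by $A,\ell,B,m$ (where $A,B$ are points and $\ell,m$ are lines), consider the incidence condition $$( * )\qquad \text{the points } A,\ B,\ \text{and } \ell\cap m \text{ are collinear.}$$ If condition $( * )$ holds for all tiles but one, then it also holds for the remaining tile.
   Context: A tiling of a closed oriented surface by quadrilateral tiles is a finite cell decomposition of the surface in which every 2-cell (tile) is a topological quadrilateral, i.e. a disk whose boundary walk consists of four edges and passes through four (marked) vertices. Two vertices are adjacent if they are joined by an edge of the tiling. If two opposite corners of a tile are the same vertex of the tiling (so that $A=B$ or $\ell=m$), condition $( * )$ for that tile is regarded as automatically satisfied. *)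

(* Defs.v *)
From HB Require Import structures.
From mathcomp Require Import all_boot all_order all_fingroup all_algebra.
From mathcomp Require Import reals complex.

Set Implicit Arguments.
Unset Strict Implicit.
Unset Printing Implicit Defensive.

Import GRing.Theory.
Local Open Scope ring_scope.

(* A finite cell decomposition of a closed oriented surface into quadrilaterals,
   encoded as a combinatorial map.  A dart is a side of a tile, directed along
   the boundary of the tile with respect to the orientation of the surface.
   [face] sends a side to the next side of the same tile; [edge] sends a side to
   the side (of the same or of another tile) with which it is glued, which runs
   along the same edge of the tiling in the opposite direction. *)
Record quad_tiling := QuadTiling {
  dart : finType;
  edge : {perm dart};
  face : {perm dart};
  edge_involutive : involutive edge;
  edge_neq : forall x, edge x != x;
  card_face_orbit : forall x, #|porbit face x| = 4
}.

(* The dart [face (edge x)] has the same starting point as [x], and is the next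
   one in the rotation around that point. *)
Definition node (T : quad_tiling) : {perm dart T} := (edge T * face T)%g.

Definition vertex (T : quad_tiling) := {v : {set dart T} | v \in porbits (node T)}.
Definition tile (T : quad_tiling) := {t : {set dart T} | t \in porbits (face T)}.

Definition origin (T : quad_tiling) (x : dart T) : vertex T :=
  exist _ (porbit (node T) x) (imset_f _ isT).

(* The end point of a dart is the starting point of the next side of its tile. *)
Lemma origin_face (T : quad_tiling) (x : dart T) :
  origin (face T x) = origin (edge T x).
Proof.
apply/val_inj/eqP; rewrite /= eq_porbit_mem.
have -> : face T x = node T (edge T x) by rewrite permM edge_involutive.
exact: (mem_porbit (node T) 1 (edge T x)).
Qed.

Definition adjacent (T : quad_tiling) (u v : vertex T) : Prop :=
  exists x : dart T, origin x = u /\ origin (edge T x) = v.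

(* The vertices in [black] are black, the other ones are white. *)
Definition bicoloring (T : quad_tiling) (black : {pred vertex T}) : Prop :=
  forall u v : vertex T, adjacent u v -> (u \in black) != (v \in black).

Definition proj_point (F : fieldType) := {p : {vspace 'rV[F]_3} | \dim p == 1%N}.
Definition proj_line (F : fieldType) := {l : {vspace 'rV[F]_3} | \dim l == 2%N}.

Definition collinear (F : fieldType) (U V W : {vspace 'rV[F]_3}) : Prop :=
  exists n : proj_line F,
    [/\ (U <= val n)%VS, (V <= val n)%VS & (W <= val n)%VS].

(* Only the values of [pt] at black vertices and of [ln] at white vertices are
   relevant. *)
Definition admissible (F : fieldType) (T : quad_tiling)
    (black : {pred vertex T})
    (pt : vertex T -> proj_point F) (ln : vertex T -> proj_line F) : Prop :=
  [/\ {in black &, injective pt},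
      {in [predC black] &, injective ln} &
      forall u v : vertex T, u \in black -> v \notin black -> adjacent u v ->
        ~~ (val (pt u) <= val (ln v))%VS].

(* The corners A, l, B, m of a tile are read off in cyclic order, starting from
   a side [x] whose origin A is black. *)
Definition incidence_condition (F : fieldType) (T : quad_tiling)
    (black : {pred vertex T})
    (pt : vertex T -> proj_point F) (ln : vertex T -> proj_line F)
    (t : tile T) : Prop :=
  forall x : dart T, x \in val t -> origin x \in black ->
    let A := origin x in
    let l := origin (face T x) in
    let B := origin (face T (face T x)) in
    let m := origin (face T (face T (face T x))) in
    [\/ A = B, l = m |
        collinear (val (pt A)) (val (pt B)) (val (ln l) :&: val (ln m))%VS].

(* Main.v *)
Require Import Defs.
From mathcomp Require Import all_boot all_order all_fingroup all_algebra.
From mathcomp Require Import reals complex.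
Set Implicit Arguments.
Unset Strict Implicit.
Unset Printing Implicit Defensive.
Import GRing.Theory.
Local Open Scope ring_scope.

(** Fix homogeneous coordinates for each point and a linear form for each line,
    and write [p, l] for the value of the form of l on the vector of p.  The
    vector [B, l] A - [A, l] B spans the intersection of l with the line AB, so
    the incidence condition of a nondegenerate tile A, l, B, m says exactly that this
    vector also lies on m, that is

      [A, l] [B, m] / ([B, l] [A, m]) = 1.

    When A = B or l = m the quotient is 1 as well, so in all cases the condition
    says that this quotient, a multiplicative boundary integral around the tile,
    is trivial (lemma [incidence_tile_weight]).

    Orient the boundary of the tile and give to each side the weight [p, l] if
    it runs from its point p to its line l, and 1 / [p, l] if it runs from l to
    p: the quotient is the product of the weights of the four sides.  On a
    closed oriented surface each edge is a side exactly twice, in opposite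
    directions, so the weights of all sides multiply to 1 (lemma
    [prod_side_weight]).  The product over all tiles of the quotients is thus 1,
    and if all quotients but one are 1, so is the last.  The argument holds over
    any field. *)

(** * Linear forms defining lines, and collinearity *)

(** The form is the projection onto a complementary line, read in a basis of
    that line. *)
Lemma hyperplane_functional (F : fieldType) (V : vectType F) (H : {vspace V}) :
  (\dim H).+1 = \dim {:V} -> exists f : 'Hom(V, F^o), lker f = H.
Proof.
move=> dimH; pose e := vpick H^C; pose t := [tuple e].
have dimC : \dim H^C = 1%N by rewrite dimv_compl -dimH subSnn.
have HC0 : H^C%VS != 0%VS by rewrite -dimv_eq0 dimC.
have HCe : H^C%VS = <<t>>%VS.
  rewrite span_seq1; apply/esym/eqP.
  by rewrite eqEdim -memvE memv_pick dimC dim_vline vpick0 HC0.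
have dxHC : (H^C :&: H = 0)%VS by rewrite capvC capv_compl.
have full v : v \in (H^C + H)%VS by rewrite addvC addv_complf memvf.
exists (linfun (coord t 0 : V -> F^o) \o daddv_pi H^C H)%VF.
apply/vspaceP=> v; rewrite memv_ker comp_lfunE lfunE /=.
apply/eqP/idP => [c0 | vH].
- have : daddv_pi H^C H v \in <<t>>%VS by rewrite -HCe memv_pi.
  move/coord_span; rewrite big_ord1 c0 scale0r => p0.
  by rewrite -(daddv_pi_add dxHC (full v)) p0 add0r memv_pi.
- have := daddv_pi_add dxHC (full v).
  rewrite [daddv_pi H _ v]daddv_pi_id //; last by rewrite capvC.
  by move/(canRL (addrK _)); rewrite subrr => ->; rewrite linear0.
Qed.

Lemma proj_pointE (F : fieldType) (p : proj_point F) : val p = <[vpick (val p)]>%VS.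
Proof.
have dp := eqP (valP p).
apply/esym/eqP; rewrite eqEdim -memvE memv_pick /= dp dim_vline vpick0.
by rewrite -dimv_eq0 dp.
Qed.

(** The meet of the two kernels is a single projective point.  If it lies on the
    line ab, a representative s a + t b gives a nontrivial linear relation
    between the columns (f a, g a) and (f b, g b); conversely, the vanishing of
    their determinant puts the zero f b a - f a b of f into the kernel of g. *)
Lemma collinear_meet_kernels (F : fieldType) (a b : 'rV[F]_3) (f g : 'Hom('rV[F]_3, F^o)) :
  \dim (<[a]> + <[b]>) = 2%N -> \dim (lker f) = 2%N -> \dim (lker g) = 2%N ->
  lker f != lker g -> f a != 0 ->
  collinear <[a]> <[b]> (lker f :&: lker g) <-> f a * g b = f b * g a.
Proof.
have dimR : \dim {: 'rV[F]_3} = 3 by rewrite dimvf.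
move=> dimab dimf dimg neq_fg fa0.
have sub2 (n : {vspace 'rV[F]_3}) : \dim n = 2%N -> (<[a]> <= n)%VS -> (<[b]> <= n)%VS ->
    n = (<[a]> + <[b]>)%VS.
  by move=> dn an bn; apply/esym/eqP; rewrite eqEdim subv_add an bn dn dimab.
have dim1 : \dim (lker f :&: lker g) = 1%N.
  apply/eqP; rewrite eqn_leq; apply/andP; split.
    suff : (\dim (lker f :&: lker g) < \dim (lker f))%N by rewrite dimf.
    rewrite ltn_neqAle dimvS ?capvSl // andbT.
    apply: contra neq_fg; rewrite (dimv_leqif_eq (capvSl _ _)) => /eqP/capv_idPl fg.
    by rewrite eqEdim fg dimf dimg.
  have := dimv_sum_cap (lker f) (lker g); rewrite dimf dimg.
  have : (\dim (lker f + lker g) <= \dim {: 'rV[F]_3})%N by rewrite dimvS ?subvf.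
  by rewrite dimR; case: (\dim (_ :&: _)) => //; rewrite addn0 => /[swap] ->.
split=> [[n [an bn qab]] | eq_fg].
- move: qab; rewrite (sub2 _ (eqP (valP n)) an bn) => qab.
  set K := (_ :&: _)%VS in dim1 qab.
  have /memv_capP[] := memv_pick K; have := subvP qab _ (memv_pick K).
  have q0 : vpick K != 0 by rewrite vpick0 -dimv_eq0 dim1.
  move=> /memv_addP[u /vlineP[s us] [v /vlineP[t vt] qst]].
  rewrite !memv_ker qst us vt !linearD !linearZ /= => /eqP fq /eqP gq.
  have t0 : t != 0.
    apply: contra_eq_neq fq => t0; rewrite t0 scale0r addr0 scaler_eq0 negb_or fa0 andbT.
    by apply: contraNneq q0 => s0; rewrite qst us vt s0 t0 !scale0r addr0.
  apply: (mulfI t0).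
  have fb : t * f b = - (s * f a) by apply/eqP; rewrite -addr_eq0 addrC; apply/eqP.
  have gb : t * g b = - (s * g a) by apply/eqP; rewrite -addr_eq0 addrC; apply/eqP.
  by rewrite mulrCA gb mulrA fb mulrN mulNr mulrCA mulrA.
pose q : 'rV[F]_3 := (f b : F) *: a - (f a : F) *: b.
have nE : \dim (<[a]> + <[b]>) == 2%N by apply/eqP.
have q0 : q != 0.
  apply: contra_eq_neq dimab => q0.
  have ba : b \in <[a]>%VS.
    apply/vlineP; exists (f b / f a); apply: (scalerI fa0).
    by rewrite scalerA mulrCA mulfV // mulr1; apply/esym/eqP; rewrite -subr_eq0 -/q q0.
  move: ba; rewrite memvE => /addv_idPl ->.
  by rewrite dim_vline; case: (a != 0).
exists (exist (fun l : {vspace 'rV[F]_3} => \dim l == 2%N) _ nE); split=> /=; [exact: addvSl | exact: addvSr |].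
suff -> : (lker f :&: lker g)%VS = <[q]>%VS.
  rewrite -memvE memvB // memvZ //.
  - by apply: (subvP (addvSl _ _)); exact: memv_line.
  - by apply: (subvP (addvSr _ _)); exact: memv_line.
apply/esym/eqP; rewrite eqEdim dim1 dim_vline q0 andbT -memvE memv_cap !memv_ker.
rewrite !linearB !linearZ /= -[f b *: g a]eq_fg [f b *: _]mulrC.
by rewrite !scalerN !subrr eqxx.
Qed.

Lemma ex_line_form (F : fieldType) (l : proj_line F) :
  exists f : 'Hom('rV[F]_3, F^o), lker f == val l.
Proof.
have [|f <-] := @hyperplane_functional F 'rV[F]_3 (val l); last by exists f.
by rewrite dimvf (eqP (valP l)).
Qed.

Definition line_form (F : fieldType) (l : proj_line F) : 'Hom('rV[F]_3, F^o) :=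
  xchoose (ex_line_form l).

Lemma lker_line_form (F : fieldType) (l : proj_line F) : lker (line_form l) = val l.
Proof. exact/eqP/(xchooseP (ex_line_form l)). Qed.

(** The value depends on the chosen vector and form, that is up to a factor for
    the point and a factor for the line; these cancel around a tile. *)
Definition pairing (F : fieldType) (p : proj_point F) (l : proj_line F) : F :=
  line_form l (vpick (val p)).

Lemma pairing_eq0 (F : fieldType) (p : proj_point F) (l : proj_line F) :
  (pairing p l == 0) = (val p <= val l)%VS.
Proof. by rewrite [in RHS]proj_pointE -memvE -lker_line_form memv_ker. Qed.

Lemma dim_join_points (F : fieldType) (p q : proj_point F) :
  p != q -> \dim (val p + val q) = 2%N.
Proof.
move=> neq_pq; have [dp dq] := (eqP (valP p), eqP (valP q)).
have := dimv_sum_cap (val p) (val q); rewrite dp dq /=.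
suff -> : \dim (val p :&: val q) = 0%N by rewrite addn0.
apply/eqP; rewrite -leqn0 -ltnS.
suff : (\dim (val p :&: val q) < \dim (val p))%N by rewrite dp.
rewrite ltn_neqAle dimvS ?capvSl // andbT.
apply: contra neq_pq; rewrite (dimv_leqif_eq (capvSl _ _)) => /eqP/capv_idPl pq.
by rewrite -val_eqE eqEdim pq dp dq.
Qed.

Lemma collinear_pairing (F : fieldType) (p q : proj_point F) (l m : proj_line F) :
  p != q -> l != m -> ~~ (val p <= val l)%VS ->
  collinear (val p) (val q) (val l :&: val m) <->
    pairing p l * pairing q m = pairing q l * pairing p m.
Proof.
move=> neq_pq neq_lm; rewrite -pairing_eq0 => pl.
have := @collinear_meet_kernels F (vpick (val p)) (vpick (val q)) (line_form l) (line_form m).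
rewrite !lker_line_form -!proj_pointE; apply=> //.
- exact: dim_join_points.
- exact: eqP (valP l).
- exact: eqP (valP m).
Qed.

(** * Sides of tiles *)

Lemma adjacent_face (T : quad_tiling) (x : dart T) :
  adjacent (origin x) (origin (face T x)).
Proof. by exists x; rewrite origin_face. Qed.

Lemma adjacent_sym (T : quad_tiling) (u v : vertex T) : adjacent u v -> adjacent v u.
Proof. by case=> x [<- <-]; exists (edge T x); rewrite edge_involutive. Qed.

Lemma face4 (T : quad_tiling) (x : dart T) :
  face T (face T (face T (face T x))) = x.
Proof. by have := iter_porbit (face T) x; rewrite card_face_orbit. Qed.

Lemma big_tile (T : quad_tiling) (F : fieldType) (w : dart T -> F) (x : dart T) :
  \prod_(y in porbit (face T) x) w y =
    w x * w (face T x) * w (face T (face T x)) * w (face T (face T (face T x))).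
Proof.
rewrite (eq_bigl _ _ (porbit_traject (face T) x)) -big_uniq ?uniq_traject_porbit //=.
by rewrite card_face_orbit /= !big_cons big_nil mulr1 !mulrA.
Qed.

(** * Weights of sides *)

Section Weight.

Variables (F : fieldType) (T : quad_tiling) (black : {pred vertex T}).
Variables (pt : vertex T -> proj_point F) (ln : vertex T -> proj_line F).
Hypotheses (col : bicoloring black) (adm : admissible black pt ln).

Definition side_weight (x : dart T) : F :=
  if origin x \in black then pairing (pt (origin x)) (ln (origin (edge T x)))
  else (pairing (pt (origin (edge T x))) (ln (origin x)))^-1.

Lemma black_edge x : (origin (edge T x) \in black) = (origin x \notin black).
Proof.
have : adjacent (origin x) (origin (edge T x)) by exists x.
by move/col; case: (_ \in _); case: (_ \in _).
Qed.

Lemma black_face x : (origin (face T x) \in black) = (origin x \notin black).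
Proof. by rewrite origin_face black_edge. Qed.

Lemma pairing_neq0 u v :
  u \in black -> v \notin black -> adjacent u v -> pairing (pt u) (ln v) != 0.
Proof. by move=> ub vw uv; rewrite pairing_eq0; case: adm => _ _; apply. Qed.

Lemma side_weight_edge x : side_weight (edge T x) = (side_weight x)^-1.
Proof.
rewrite /side_weight black_edge edge_involutive.
by case: (origin x \in black); rewrite ?invrK.
Qed.

Lemma side_weight_neq0 x : side_weight x != 0.
Proof.
have exx : adjacent (origin x) (origin (edge T x)) by exists x.
rewrite /side_weight; case: ifPn => xb.
  by rewrite pairing_neq0 ?black_edge ?negbK.
rewrite invr_eq0 pairing_neq0 ?black_edge //.
exact: adjacent_sym.
Qed.

(** The two sides glued along an edge have inverse weights; exactly one of them
    starts at a black vertex, so the product over the sides starting at white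
    vertices can be reindexed by gluing. *)
Lemma prod_side_weight : \prod_x side_weight x = 1.
Proof.
rewrite (bigID (fun x => origin x \in black)) /=.
rewrite [X in _ * X](reindex_inj (@perm_inj _ (edge T))) /=.
under [X in _ * X]eq_bigl do rewrite black_edge negbK.
rewrite -big_split big1 //= => x _.
by rewrite side_weight_edge mulfV ?side_weight_neq0.
Qed.

(** The pairings in the quotient are nonzero because neighbouring corners of a
    tile are adjacent; distinct vertices of one color carry distinct points or
    lines, so [collinear_pairing] applies outside the degenerate cases. *)
Lemma incidence_tile_weight x : origin x \in black ->
  let A := origin x in
  let l := origin (face T x) in
  let B := origin (face T (face T x)) in
  let m := origin (face T (face T (face T x))) in
  [\/ A = B, l = m |
      collinear (val (pt A)) (val (pt B)) (val (ln l) :&: val (ln m))%VS] <->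
  \prod_(y in porbit (face T) x) side_weight y = 1.
Proof.
move=> Ab A l B m.
have lw : l \notin black by rewrite black_face Ab.
have Bb : B \in black by rewrite black_face.
have mw : m \notin black by rewrite black_face Bb.
have Al : adjacent A l by exact: adjacent_face.
have lB : adjacent l B by exact: adjacent_face.
have Bm : adjacent B m by exact: adjacent_face.
have mA : adjacent m A by rewrite /A -[x in origin x]face4; exact: adjacent_face.
have -> : \prod_(y in porbit (face T) x) side_weight y =
  (pairing (pt A) (ln l) * pairing (pt B) (ln m)) /
  (pairing (pt B) (ln l) * pairing (pt A) (ln m)).
  rewrite big_tile /side_weight -!origin_face face4 -/A -/l -/B -/m.
  by rewrite Ab Bb (negPf lw) (negPf mw) invfM !mulrA [in RHS](mulrAC _ (pairing (pt B) (ln m))).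
have Blp : pairing (pt B) (ln l) != 0 by apply: pairing_neq0 => //; exact: adjacent_sym.
have Amp : pairing (pt A) (ln m) != 0 by apply: pairing_neq0 => //; exact: adjacent_sym.
have den0 := mulf_neq0 Blp Amp.
have eq1 (u v : F) : v != 0 -> u / v = 1 <-> u = v.
  by move=> v0; split=> [/(canRL (mulfVK v0))|->]; rewrite ?mul1r ?mulfV.
rewrite eq1 //; have [ptI lnI out] := adm.
have [eqAB | neqAB] := eqVneq A B.
  by split=> [_|_]; [rewrite eqAB | constructor 1].
have [eqlm | neqlm] := eqVneq l m.
  by split=> [_|_]; [rewrite eqlm mulrC | constructor 2].
rewrite -collinear_pairing ?out //.
- split=> [|c]; last by constructor 3.
  by case=> // e; [rewrite e eqxx in neqAB | rewrite e eqxx in neqlm].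
- by apply: contraNneq neqAB => e; apply/eqP/ptI.
- by apply: contraNneq neqlm => e; apply/eqP/lnI.
Qed.

(** A tile always has a side starting at a black vertex, and the product of its
    weights does not depend on which of them the corners are read from. *)
Lemma incidence_weight (t : tile T) :
  incidence_condition black pt ln t <-> \prod_(x in val t) side_weight x = 1.
Proof.
split=> [inc | wt x xt xb]; last first.
  apply/incidence_tile_weight => //; apply: etrans wt; apply: eq_bigl => y.
  have /imsetP[z _ tz] := valP t; rewrite tz in xt *.
  by move: xt; rewrite -eq_porbit_mem => /eqP ->.
have [x xb tx] : exists2 x, origin x \in black & val t = porbit (face T) x.
  have /imsetP[z _ tz] := valP t.
  have [zb | zw] := boolP (origin z \in black); first by exists z.
  exists (face T z); rewrite ?black_face // tz; apply/esym/eqP.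
  by rewrite eq_porbit_mem; exact: (mem_porbit (face T) 1 z).
rewrite tx; apply/incidence_tile_weight => //; apply: inc => //.
by rewrite tx porbit_id.
Qed.

Lemma prod_tiles : \prod_(t : tile T) \prod_(x in val t) side_weight x = 1.
Proof.
pose tile_of x : tile T := exist _ (porbit (face T) x) (imset_f _ isT).
rewrite -[RHS]prod_side_weight (partition_big tile_of predT) //=.
apply: eq_bigr => t _; apply: eq_bigl => x.
rewrite -val_eqE /=; have /imsetP[z _ ->] := valP t.
by rewrite eq_porbit_mem.
Qed.

Lemma incidence_last_tile (t0 : tile T) :
  (forall t, t != t0 -> incidence_condition black pt ln t) ->
  incidence_condition black pt ln t0.
Proof.
move=> inc; apply/incidence_weight.
have := prod_tiles; rewrite (bigD1 t0) //= [X in _ * X]big1 ?mulr1 // => t /inc.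
by move/incidence_weight.
Qed.

End Weight.

Theorem theorem1p1 (R : realType) (T : quad_tiling) (black : {pred vertex T})
  (hblack : bicoloring black) :
  (forall (pt : vertex T -> proj_point R) (ln : vertex T -> proj_line R),
     admissible black pt ln ->
     forall t0 : tile T,
       (forall t : tile T, t != t0 -> incidence_condition black pt ln t) ->
       incidence_condition black pt ln t0)
  /\
  (forall (pt : vertex T -> proj_point R[i]) (ln : vertex T -> proj_line R[i]),
     admissible black pt ln ->
     forall t0 : tile T,
       (forall t : tile T, t != t0 -> incidence_condition black pt ln t) ->
       incidence_condition black pt ln t0).
Proof. by split=> pt ln adm t0; exact: incidence_last_tile. Qed.
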